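(* Let $R$ be a ring without nontrivial idempotents such that $3\in U(R)$. The following are equivalent: (1) every element of $R$ is a sum of an idempotent and a tripotent that commute; (2) $R$ is local such that $R/J(R)\cong \mathbb{Z}_2$, and $x^2=1$ for all $x\in U(R)$; (3) $R/J(R)\cong\mathbb{Z}_2$, and for every $x\in J(R)$ we have $x^2=2x$; (4) $R$ is weakly tripotent. Consequently, every weakly tripotent ring without nontrivial idempotents is commutative.
   Context: Rings are associative with identity (not assumed commutative). $U(R)$ is the group of units of $R$, $J(R)$ is the Jacobson radical of $R$, and $\mathbb{Z}_2=\mathbb{Z}/2\mathbb{Z}$. An element $x$ of a ring is tripotent if $x^3=x$. A ring $R$ is weakly tripotent if for every $x\in R$ at least one of the elements $x$ or $1+x$ is tripotent. A ring is without nontrivial idempotents if it has no idempotents other than $0$ and $1$. *)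

(* Defs.v *)
From HB Require Import structures.
From mathcomp Require Import all_boot all_algebra.
From mathcomp Require Import generic_quotient ring_quotient.
From mathcomp Require Import boolp.

Set Implicit Arguments.
Unset Strict Implicit.
Unset Printing Implicit Defensive.

Import GRing.Theory.
Local Open Scope ring_scope.
Local Open Scope quotient_scope.

Section Elements.
Variable R : nzRingType.
Implicit Types x e t : R.

(* [GRing.unit] needs a [unitRingType]; this is the same notion for a ring
   that carries no inverse operation. *)
Definition is_unit x : Prop := exists y, y * x = 1 /\ x * y = 1.

Definition is_idempotent e : Prop := e ^+ 2 = e.

Definition is_tripotent t : Prop := t ^+ 3 = t.

End Elements.

Definition no_nontrivial_idempotents (R : nzRingType) : Prop :=
  forall e : R, is_idempotent e -> e = 0 \/ e = 1.

Definition weakly_tripotent (R : nzRingType) : Prop :=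
  forall x : R, is_tripotent x \/ is_tripotent (1 + x).

Definition commuting_idempotent_tripotent_sums (R : nzRingType) : Prop :=
  forall x : R, exists e t : R,
    [/\ is_idempotent e, is_tripotent t, GRing.comm e t & x = e + t].

(* [idealr_closed] is closure under [a * u + v] and exclusion of [1], that is,
   being a proper left ideal (although its documentation says "right").
   In the presence of [boolp], boolean predicates represent all subsets. *)
Definition maximal_left_ideal (R : nzRingType) (M : {pred R}) : Prop :=
  idealr_closed M /\
  forall N : {pred R}, idealr_closed N -> {subset M <= N} -> {subset N <= M}.

Definition local_ring (R : nzRingType) : Prop :=
  exists2 M : {pred R}, maximal_left_ideal M &
    forall N : {pred R}, maximal_left_ideal N -> N =i M.

Definition jacobson (R : nzRingType) : {pred R} :=
  fun x => `[< forall M : {pred R}, maximal_left_ideal M -> x \in M >].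
Arguments jacobson R : clear implicits.

Section JacobsonIdeal.
Variable R : nzRingType.
Implicit Types (x y a : R) (M : {pred R}).

Lemma jacobsonP x :
  reflect (forall M : {pred R}, maximal_left_ideal M -> x \in M)
          (x \in jacobson R).
Proof. exact: asboolP. Qed.

Lemma jacobson_zmod_closed : zmod_closed (jacobson R).
Proof.
split=> [|x y /jacobsonP Jx /jacobsonP Jy]; apply/jacobsonP => M maxM.
  by case: maxM.1.
have [_ _ MP] := maxM.1.
by rewrite addrC -mulN1r MP ?Jx ?Jy.
Qed.

HB.instance Definition _ :=
  GRing.isZmodClosed.Build R (jacobson R) jacobson_zmod_closed.

Lemma jacobson_mull a x : x \in jacobson R -> a * x \in jacobson R.
Proof.
move=> /jacobsonP Jx; apply/jacobsonP => M maxM; have [M0 _ MP] := maxM.1.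
by rewrite -[a * x]addr0 MP // Jx.
Qed.

(* For a maximal left ideal [M] and [a \notin M], the left ideal
   [{z | z * a \in M}] is again maximal. *)
Lemma colon_maximal M a : maximal_left_ideal M -> a \notin M ->
  maximal_left_ideal [pred z | z * a \in M].
Proof.
move=> [[M0 M1 MP] maxM] aM; split.
  split; rewrite ?inE ?mul0r ?mul1r //.
  by move=> b u v; rewrite !inE mulrDl -mulrA; apply: MP.
move=> N [N0 N1 NP] sub b bN; apply: contraT; rewrite inE => baM.
pose K : {pred R} := fun z => `[< exists c, z - c * (b * a) \in M >].
have KP z : reflect (exists c, z - c * (b * a) \in M) (z \in K).
  exact: asboolP.
have [K1|K1] := boolP (1 \in K).
  have aK : exists c, a - c * (b * a) \in M.
    move/KP: K1 => [c cM]; exists (a * c).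
    by have := MP a _ _ cM M0; rewrite addr0 mulrBr mulr1 -[a * c * _]mulrA.
  have [c cM] := aK; case/negP: N1.
  have Nc : 1 - c * b \in N.
    by apply: sub; rewrite inE mulrBl mul1r -mulrA.
  by rewrite -[1](subrK (c * b)) addrC; apply: NP.
have idK : idealr_closed K.
  split=> //; first by apply/KP; exists 0; rewrite mul0r subr0.
  move=> d u v /KP[c cM] /KP[c' c'M]; apply/KP; exists (d * c + c').
  have -> : d * u + v - (d * c + c') * (b * a)
          = d * (u - c * (b * a)) + (v - c' * (b * a)).
    by rewrite mulrBr mulrDl -[d * c * _]mulrA opprD addrACA.
  exact: MP.
case/negP: baM; apply: (maxM K idK).
  by move=> z zM; apply/KP; exists 0; rewrite mul0r subr0.
by apply/KP; exists 1; rewrite mul1r subrr.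
Qed.

Lemma jacobson_mulr a x : x \in jacobson R -> x * a \in jacobson R.
Proof.
move=> /jacobsonP Jx; apply/jacobsonP => M maxM.
have [aM|aM] := boolP (a \in M); last by have := Jx _ (colon_maximal maxM aM).
by have [M0 _ MP] := maxM.1; rewrite -[x * a]addr0 MP.
Qed.

End JacobsonIdeal.

(* [ring_quotient] puts a multiplication on [Quotient.quot] only for
   commutative rings, so the ring structure of R/J(R) is built here. *)
Definition jacobson_quot (R : nzRingType) : Type :=
  Quotient.quot (jacobson R : zmodClosed R).

Section JacobsonQuotient.
Variable R : nzRingType.
Local Notation Q := (jacobson_quot R).

HB.instance Definition _ := GRing.Zmodule.on Q.
HB.instance Definition _ : EqQuotient R (Quotient.equiv (jacobson R)) Q :=
  EqQuotient.on Q.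

Definition jq_one : Q := \pi_Q 1.
Definition jq_mul (u v : Q) : Q := \pi_Q (repr u * repr v).

Lemma jq_eqP (x y : R) : reflect (\pi_Q x = \pi_Q y) (x - y \in jacobson R).
Proof. by rewrite (Quotient.idealrBE (jacobson R)); exact: eqP. Qed.

Lemma jq_piM (x y : R) : jq_mul (\pi_Q x) (\pi_Q y) = \pi_Q (x * y).
Proof.
apply/jq_eqP; set x' := repr _; set y' := repr _.
have Jx : x' - x \in jacobson R by apply/jq_eqP; rewrite reprK.
have Jy : y' - y \in jacobson R by apply/jq_eqP; rewrite reprK.
rewrite -[x' * y'](subrK (x * y')) -addrA -mulrBl -mulrBr.
by apply: rpredD; [apply: jacobson_mulr|apply: jacobson_mull].
Qed.

Lemma jq_piD (x y : R) : \pi_Q x + \pi_Q y = \pi_Q (x + y).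
Proof. exact: esym (Quotient.pi_add (jacobson R) x y). Qed.

Lemma jq_mulA : associative jq_mul.
Proof.
elim/quotW=> x; elim/quotW=> y; elim/quotW=> z.
by rewrite (jq_piM y z) (jq_piM x (y * z)) (jq_piM x y) (jq_piM (x * y)) mulrA.
Qed.

Lemma jq_mul1q : left_id jq_one jq_mul.
Proof. by elim/quotW=> x; rewrite (jq_piM 1 x) mul1r. Qed.

Lemma jq_mulq1 : right_id jq_one jq_mul.
Proof. by elim/quotW=> x; rewrite (jq_piM x 1) mulr1. Qed.

Lemma jq_mulDl : left_distributive jq_mul +%R.
Proof.
elim/quotW=> x; elim/quotW=> y; elim/quotW=> z.
by rewrite (jq_piD x y) (jq_piM (x + y)) (jq_piM x) (jq_piM y) jq_piD mulrDl.
Qed.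

Lemma jq_mulDr : right_distributive jq_mul +%R.
Proof.
elim/quotW=> x; elim/quotW=> y; elim/quotW=> z.
by rewrite (jq_piD y z) (jq_piM x (y + z)) (jq_piM x y) (jq_piM x z) jq_piD mulrDr.
Qed.

HB.instance Definition _ := GRing.Zmodule_isPzRing.Build Q
  jq_mulA jq_mul1q jq_mulq1 jq_mulDl jq_mulDr.

End JacobsonQuotient.

Definition ring_isomorphic (A B : pzRingType) : Prop :=
  exists f : {rmorphism A -> B}, bijective f.

(* Main.v *)
Require Import Defs.
From HB Require Import structures.
From mathcomp Require Import all_boot all_algebra.
From mathcomp Require Import generic_quotient boolp classical_sets.
Local Open Scope ring_scope.

Set Implicit Arguments.
Unset Strict Implicit.
Unset Printing Implicit Defensive.

Import GRing.Theory.

(** In a ring without nontrivial idempotents the square of a tripotent is [0]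
    or [1], so (1) and (4) both say that every [x] satisfies [x ^+ 2 = 1] or
    [(1 - x) ^+ 2 = 1], the latter being [x ^+ 2 = 2 x].  Taking [x = 3] gives
    [8 = 0] or [3 = 0].  If [8 = 0], an element with [x ^+ 2 = 2 x] is not left
    invertible (otherwise [x = 2] would be), and such elements form the unique
    maximal left ideal, of index 2.  Conversely [1 - x] is a unit for [x] in
    the radical, which links [u ^+ 2 = 1] on units to [x ^+ 2 = 2 x] on [J(R)].
    For commutativity it is enough to commute [u] and [v] with
    [u ^+ 2 = v ^+ 2 = 1]; there [u v] either squares to [1] or equals [2]. *)

Definition square_dichotomy (R : nzRingType) : Prop :=
  forall x : R, x ^+ 2 = 1 \/ x ^+ 2 = 2%:R * x.

(** * Tripotents, the square dichotomy and commutativity *)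

Section Tripotents.
Variable R : nzRingType.
Implicit Types x t u v : R.

Lemma sqr_1B_eq1 x : (1 - x) ^+ 2 = 1 <-> x ^+ 2 = 2%:R * x.
Proof.
have -> : (1 - x) ^+ 2 = 1 + (x ^+ 2 - 2%:R * x).
  rewrite expr2 mulrBl mul1r mulrBr mulr1 -expr2 opprB mulr_natl mulr2n.
  by rewrite opprD -addrA [- x + _]addrCA.
split=> [/(congr1 (fun y => y - 1))|->]; last by rewrite subrr addr0.
by rewrite addrAC subrr add0r => /subr0_eq.
Qed.

Lemma sqr1_tripotent x : x ^+ 2 = 1 -> is_tripotent x.
Proof. by move=> x2; rewrite /is_tripotent exprS x2 mulr1. Qed.

(** The square [t ^+ 2] is idempotent, as [t ^+ 4 = t ^+ 3 * t = t ^+ 2]; if it vanishes, so does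
    [t = t * t ^+ 2]. *)
Lemma tripotent_eq0_or_sqr1 t : no_nontrivial_idempotents R ->
  is_tripotent t -> t = 0 \/ t ^+ 2 = 1.
Proof.
move=> idR t3; have [|t2|] := idR (t ^+ 2); last by right.
  by rewrite /is_idempotent -exprM (exprS t 3) t3 -expr2.
by left; rewrite -t3 exprS t2 mulr0.
Qed.

Lemma sums_square_dichotomy : no_nontrivial_idempotents R ->
  commuting_idempotent_tripotent_sums R <-> square_dichotomy R.
Proof.
move=> idR; split=> [sumR x|dR x].
  have [e [t [/idR e01 /(tripotent_eq0_or_sqr1 idR) t01 _ ->]]] := sumR x.
  case: e01 => ->; rewrite ?add0r; case: t01 => [->|t2].
  - by right; rewrite expr0n mulr0.
  - by left.
  - by left; rewrite addr0 expr1n.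
  - by right; apply/sqr_1B_eq1; rewrite opprD addNKr sqrrN.
have [x2|/sqr_1B_eq1 x2] := dR x.
  exists 0, x; split; rewrite ?add0r //; last 1 first.
  - exact/commr_sym/commr0.
  - by rewrite /is_idempotent expr0n.
  exact: sqr1_tripotent.
exists 1, (x - 1); split; last by rewrite addrC subrK.
- by rewrite /is_idempotent expr1n.
- by apply: sqr1_tripotent; rewrite -sqrrN opprB.
- exact/commr_sym/commr1.
Qed.

Lemma weakly_tripotent_square_dichotomy : no_nontrivial_idempotents R ->
  weakly_tripotent R <-> square_dichotomy R.
Proof.
move=> idR; split=> [wR x|dR x].
  (* Used at [- x], since [1 + (- x)] is the [1 - x] of [sqr_1B_eq1]. *)
  have [] := wR (- x) => /(tripotent_eq0_or_sqr1 idR).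
    rewrite sqrrN => -[/eqP|]; last by left.
    by rewrite oppr_eq0 => /eqP->; right; rewrite expr0n mulr0.
  move=> [/subr0_eq <-|/sqr_1B_eq1]; last by right.
  by left; rewrite expr1n.
have [|/sqr_1B_eq1] := dR (- x); rewrite ?sqrrN ?opprK => /sqr1_tripotent.
  by left.
by right.
Qed.

Lemma square_dichotomy_comm : square_dichotomy R ->
  forall x y : R, x * y = y * x.
Proof.
move=> dR.
have commU u v : u ^+ 2 = 1 -> v ^+ 2 = 1 -> GRing.comm u v.
  rewrite /GRing.comm => u2 v2; have uvK : v * u * (u * v) = 1.
    by rewrite mulrA -[v * u * u]mulrA -expr2 u2 mulr1 -expr2.
  (* [v * u] is inverse to [u * v]. If [u * v] squares to [1], it is its own inverse, hence equals
     [v * u]. Otherwise cancelling gives [u * v = 2], so [u = 2 * v] commutes with [v]. *)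
  have [uv2|uv2] := dR (u * v).
    by rewrite -[RHS]mulr1 -uv2 expr2 [RHS]mulrA uvK mul1r.
  have uv_eq2 : u * v = 2%:R.
    rewrite -[u * v]mul1r -uvK -mulrA -expr2 uv2 mulrA.
    by rewrite [v * u * _]commr_nat -mulrA uvK mulr1.
  have -> : u = 2%:R * v by rewrite -uv_eq2 -mulrA -expr2 v2 mulr1.
  by rewrite mulrA commr_nat.
have commUx u x : u ^+ 2 = 1 -> GRing.comm u x.
  move=> u2; have [x2|/sqr_1B_eq1 x2] := dR x; first exact: commU.
  (* Here [x = 1 - w] with [w ^+ 2 = 1]. *)
  rewrite -[x](subKr 1); apply: commrB (commr1 u) _; exact: commU.
move=> x y; apply: commr_sym.
have [x2|/sqr_1B_eq1 x2] := dR x; first exact/commr_sym/commUx.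
rewrite -[x](subKr 1); apply: commrB (commr1 y) _; exact/commr_sym/commUx.
Qed.

End Tripotents.

(** * Maximal left ideals and the Jacobson radical *)

Section Radical.
Variable R : nzRingType.
Implicit Types (x y : R) (M N I : {pred R}).

(** Zorn's lemma for the proper left ideals containing [I]: the union of a nonempty chain stays
    proper because no member contains [1]. *)
Lemma sub_maximal_left_ideal I : idealr_closed I ->
  exists2 M : {pred R}, maximal_left_ideal M & {subset I <= M}.
Proof.
move=> idI; pose P M : bool := `[< idealr_closed M /\ {subset I <= M} >].
have PP M : P M -> idealr_closed M /\ {subset I <= M} by move/asboolP.
have PI : P I by apply/asboolP; split.
pose T := {M : {pred R} | P M}.
pose le (s t : T) : bool := `[< {subset sval s <= sval t} >].
pose t0 : T := exist _ I PI.
have [s|r s t /asboolP rs /asboolP st|A totA|[M PM] maxM] := @ZL_preorder T t0 le.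
- exact/asboolP.
- by apply/asboolP => x /rs /st.
- have [[s0 As0]|A0] := pselect (exists s, A s); last first.
    (* The empty chain is bounded by [I] itself. *)
    by exists t0 => s As; case: A0; exists s.
  pose U : {pred R} := fun x => `[< exists2 s, A s & x \in sval s >].
  have UP x : reflect (exists2 s, A s & x \in sval s) (x \in U).
    exact: asboolP.
  have PU : P U.
    apply/asboolP; split; last first.
      by move=> x Ix; apply/UP; exists s0 => //; apply: (PP _ (valP s0)).2.
    split.
    + by apply/UP; exists s0 => //; have [[]] := PP _ (valP s0).
    + by apply/UP => -[s _]; apply/negP; have [[]] := PP _ (valP s).
    move=> a u v /UP[s As us] /UP[t At vt]; apply/UP.
    have [/asboolP st|/asboolP ts] := totA s t As At.
      by exists t => //; have [[_ _ tP] _] := PP _ (valP t); apply: tP => //; apply: st.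
    by exists s => //; have [[_ _ sP] _] := PP _ (valP s); apply: sP => //; apply: ts.
  by exists (exist _ U PU) => s As; apply/asboolP => x xs; apply/UP; exists s.
have [idM IM] := PP _ PM; exists M => //; split=> // N idN MN.
have PN : P N by apply/asboolP; split=> // x /IM /MN.
by have /asboolP := maxM (exist _ N PN) (introT (asboolP _) MN).
Qed.

(** Otherwise the left ideal generated by [1 - x] is proper and lies in a maximal one, which
    contains [x] as well, hence [1]. *)
Lemma jacobson_left_inv x : x \in jacobson R -> exists y, y * (1 - x) = 1.
Proof.
move=> /jacobsonP Jx; apply: contrapT => noinv.
pose I : {pred R} := fun z => `[< exists c, z = c * (1 - x) >].
have IP z : reflect (exists c, z = c * (1 - x)) (z \in I) by exact: asboolP.
have idI : idealr_closed I.
  split; first by apply/IP; exists 0; rewrite mul0r.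
    by apply/IP => -[c c1]; apply: noinv; exists c.
  move=> a _ _ /IP[c ->] /IP[d ->]; apply/IP; exists (a * c + d).
  by rewrite mulrDl mulrA.
have [M maxM IM] := sub_maximal_left_ideal idI.
have [_ /negP M1 MP] := maxM.1; apply: M1.
have -> : 1 = 1 * x + (1 - x) by rewrite mul1r addrC subrK.
by apply: MP; [exact: Jx|apply: IM; apply/IP; exists 1; rewrite mul1r].
Qed.

(** A left inverse [y] of [1 - x] equals [1 + y * x], so it has a left inverse too; this must be
    [1 - x]. *)
Lemma jacobson_1B_unit x : x \in jacobson R -> is_unit (1 - x).
Proof.
move=> Jx; have [y yx] := jacobson_left_inv Jx.
have [z zy] : exists z, z * y = 1.
  have -> : y = 1 - - (y * x) by rewrite opprK -yx mulrBr mulr1 subrK.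
  by apply: jacobson_left_inv; rewrite rpredN; apply: jacobson_mull.
exists y; split=> //.
by have <- : z = 1 - x by rewrite -[LHS]mulr1 -[in LHS]yx mulrA zy mul1r.
Qed.

(** A proper left ideal has no left invertible element, so it lies inside [M]. *)
Lemma maximal_local M : idealr_closed M ->
    (forall x, x \notin M -> exists y, y * x = 1) ->
  maximal_left_ideal M /\ forall N, maximal_left_ideal N -> N =i M.
Proof.
move=> idM invM.
have sub N : idealr_closed N -> {subset N <= M}.
  move=> [N0 N1 NP] x Nx; apply: contraT => /invM [y yx].
  by case/negP: N1; rewrite -yx -[y * x]addr0; apply: NP.
split; first by split=> // N idN _; apply: sub.
move=> N [idN maxN] x; apply/idP/idP; first exact: sub.
exact: (maxN M idM (sub N idN)).
Qed.

Lemma jacobson_local M : maximal_left_ideal M ->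
  (forall N, maximal_left_ideal N -> N =i M) -> jacobson R =i M.
Proof.
move=> maxM uniqM x; apply/jacobsonP/idP => [|Mx N /uniqM ->//].
exact.
Qed.

End Radical.

(** * The quotient by the radical and the two-element ring *)

Lemma ring_isomorphic_Z2 (Q : pzRingType) :
  ring_isomorphic Q 'Z_2 <-> (1 != 0 :> Q) /\ (forall q : Q, q = 0 \/ q = 1).
Proof.
split=> [[f [g fK gK]]|[Q1 Q01]].
  have f_inj := can_inj fK; split.
    by apply/eqP => /(congr1 f); rewrite rmorph1 rmorph0.
  move=> q; case fq: (f q) => [[|[|//]] lt_i].
    by left; apply: f_inj; rewrite fq rmorph0; apply: val_inj.
  by right; apply: f_inj; rewrite fq rmorph1; apply: val_inj.
pose f (q : Q) : 'Z_2 := (q != 0)%:R.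
(* The alternative [1 + 1 = 1] would give [1 = 0]. *)
have two0 : 1 + 1 = 0 :> Q.
  have [//|/eqP] := Q01 (1 + 1).
  by rewrite -subr_eq0 addrK (negPf Q1).
have N1 : - 1 = 1 :> Q by apply/eqP; rewrite eq_sym -addr_eq0 two0.
have fB : zmod_morphism f.
  move=> x y; case: (Q01 x) => ->; case: (Q01 y) => ->;
    by rewrite /f ?subr0 ?sub0r ?N1 ?two0 ?eqxx ?Q1; apply: val_inj.
have fM : monoid_morphism f.
  split; first by rewrite /f Q1.
  move=> x y; case: (Q01 x) => ->; case: (Q01 y) => ->;
    by rewrite /f ?mulr0 ?mul0r ?mul1r ?eqxx ?Q1 ?mulr0 ?mul0r ?mul1r.
pose fz := GRing.isZmodMorphism.Build Q 'Z_2 f fB.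
pose fm := GRing.isMonoidMorphism.Build Q 'Z_2 f fM.
pose F : {rmorphism Q -> 'Z_2} := HB.pack f fz fm.
exists F; exists (fun i : 'Z_2 => (i : nat)%:R) => [q|[[|[|//]] lt_i]].
- by case: (Q01 q) => ->; rewrite /= /f ?eqxx ?Q1.
- by rewrite /= /f eqxx; apply: val_inj.
- by rewrite /= /f Q1; apply: val_inj.
Qed.

Lemma jacobson_quot_Z2 (R : nzRingType) :
  ring_isomorphic (jacobson_quot R) 'Z_2 <->
  1 \notin jacobson R /\
    forall x : R, x \in jacobson R \/ 1 - x \in jacobson R.
Proof.
have pi0 (x : R) : \pi_(jacobson_quot R)%qT x = 0 <-> x \in jacobson R.
  have -> : 0 = \pi_(jacobson_quot R)%qT 0.
    by apply: (addrI (\pi_(jacobson_quot R)%qT 0)); rewrite jq_piD !addr0.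
  by rewrite -[X in _ <-> X \in _]subr0; split=> /jq_eqP.
have pi1 (x : R) : \pi_(jacobson_quot R)%qT x = 1 <-> 1 - x \in jacobson R.
  by split=> [e|/jq_eqP /esym]; first exact/jq_eqP/esym.
split=> [/ring_isomorphic_Z2[Q1 Q01]|[J1 J01]].
  split; first by apply/negP => /pi0 /eqP; apply/negP.
  by move=> x; case: (Q01 (\pi_(jacobson_quot R)%qT x)) => [/pi0|/pi1]; [left|right].
apply/ring_isomorphic_Z2; split; first by apply/eqP => /pi0; apply/negP.
by elim/quotW => x; case: (J01 x) => [/pi0|/pi1]; [left|right].
Qed.

(** * Locality from the square dichotomy when 3 is a unit *)

Section SquareDichotomy.
Variable R : nzRingType.
Hypotheses (dR : square_dichotomy R) (unit3 : is_unit (3%:R : R)).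
Implicit Types x y : R.

Lemma square_dichotomy_char8 : 8%:R = 0 :> R.
Proof.
have [z [z3 _]] := unit3.
have sub0 m n : (m + n)%:R = n%:R :> R -> m%:R = 0 :> R.
  by rewrite natrD => /(congr1 (fun y => y - n%:R)); rewrite addrK subrr.
have [|] := dR 3%:R; rewrite expr2 -natrM => e; first exact: (sub0 8 1%N).
have e3 : 3%:R = 0 :> R by apply: (sub0 3 6); rewrite e -natrM.
by case/eqP: (oner_neq0 R); rewrite -z3 e3 mulr0.
Qed.

Lemma sqr_double_not_left_inv x y : x ^+ 2 = 2%:R * x -> y * x <> 1.
Proof.
move=> x2 yx.
have x_eq2 : x = 2%:R.
  by rewrite -[x]mul1r -yx -mulrA -expr2 x2 mulrA [y * _]commr_nat -mulrA yx mulr1.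
(* With [x = 2], the cube is [y ^+ 3 * 8]. *)
have : (y * x) ^+ 3 = 0.
  rewrite x_eq2 exprMn_comm; last exact: commr_nat.
  by rewrite -natrX square_dichotomy_char8 mulr0.
by rewrite yx expr1n => /eqP; rewrite oner_eq0.
Qed.

(** This set turns out to be the unique maximal left ideal, hence the radical. *)
Definition sqr_double : {pred R} := fun x => x ^+ 2 == 2%:R * x.

Lemma sqr_doubleN x : x \notin sqr_double -> x ^+ 2 = 1.
Proof. by have [//|/eqP] := dR x; rewrite unfold_in => ->. Qed.

Lemma sqr_double_1B x : x \in sqr_double -> (1 - x) ^+ 2 = 1.
Proof. by rewrite unfold_in => /eqP /sqr_1B_eq1. Qed.

Lemma sqr_double_idealr_closed : idealr_closed sqr_double.
Proof.
have ninv x y : x \in sqr_double -> y * x <> 1.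
  by rewrite unfold_in => /eqP; exact: sqr_double_not_left_inv.
have mulS a x : x \in sqr_double -> a * x \in sqr_double.
  move=> Sx; apply: contraT => /sqr_doubleN ax2.
  (* If [(a * x) ^+ 2 = 1], then [a * x * a] is a left inverse of [x]. *)
  by case: (ninv x (a * x * a) Sx); rewrite -mulrA -expr2.
split.
- by rewrite unfold_in expr0n mulr0.
- by apply/negP => /ninv /(_ (mulr1 1)).
move=> a x y /(mulS a) Sx Sy; move: (a * x) Sx => {}x Sx.
apply: contraT => /sqr_doubleN; set u := x + y => u2.
(* If [u = x + y] squares to [1], then [u * y = 1 - u * x] does too, as [u * x] is in the set; so
   [u * y * u] is a left inverse of [y], which is impossible. *)
have uxy : u * y = 1 - u * x by rewrite -u2 expr2 -mulrBr /u [x + y]addrC addrK.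
have := sqr_double_1B (mulS u _ Sx); rewrite -uxy expr2 mulrA.
by move/(ninv _ _ Sy).
Qed.

Lemma square_dichotomy_local :
  [/\ local_ring R, ring_isomorphic (jacobson_quot R) 'Z_2
    & forall x : R, is_unit x -> x ^+ 2 = 1].
Proof.
have idS := sqr_double_idealr_closed.
have [maxS uniqS] : maximal_left_ideal sqr_double /\
    forall N, maximal_left_ideal N -> N =i sqr_double.
  (* An element outside the set is its own inverse. *)
  by apply: maximal_local => // x /sqr_doubleN; exists x; rewrite -expr2.
have JS := jacobson_local maxS uniqS.
split; first by exists sqr_double.
- apply/jacobson_quot_Z2; rewrite JS; split; first by case: idS.
  move=> x; rewrite !JS; have [Sx|/sqr_doubleN x2] := boolP (x \in sqr_double).
    by left.
  by right; rewrite unfold_in; apply/eqP/sqr_1B_eq1; rewrite subKr.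
- move=> x [y [yx _]]; have [//|/sqr_double_not_left_inv] := dR x.
  by move/(_ _ yx).
Qed.

End SquareDichotomy.

Theorem corollary10 :
  (forall R : nzRingType,
     no_nontrivial_idempotents R -> is_unit (3%:R : R) ->
     [<-> commuting_idempotent_tripotent_sums R;
          [/\ local_ring R, ring_isomorphic (jacobson_quot R) 'Z_2
            & forall x : R, is_unit x -> x ^+ 2 = 1];
          ring_isomorphic (jacobson_quot R) 'Z_2 /\
            (forall x : R, x \in jacobson R -> x ^+ 2 = 2%:R * x);
          weakly_tripotent R])
  /\
  (forall R : nzRingType,
     weakly_tripotent R -> no_nontrivial_idempotents R ->
     forall x y : R, x * y = y * x).
Proof.
split=> [R idR unit3|R wR idR]; last first.
  exact/square_dichotomy_comm/weakly_tripotent_square_dichotomy.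
tfae.
- by move/(sums_square_dichotomy idR)/square_dichotomy_local; apply.
- move=> [_ isoR sqrU]; split=> // x Jx.
  exact/sqr_1B_eq1/sqrU/jacobson_1B_unit.
- move=> [/jacobson_quot_Z2[_ J01] sqrJ].
  apply/(weakly_tripotent_square_dichotomy idR) => x.
  (* For [x] in the radical [x ^+ 2 = 2 * x]; for [1 - x] in it, [x = 1 - (1 - x)] squares to
     [1]. *)
  have [/sqrJ|/sqrJ /sqr_1B_eq1] := J01 x; first by right.
  by rewrite subKr; left.
- by move/(weakly_tripotent_square_dichotomy idR)/(sums_square_dichotomy idR).
Qed.
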